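(* Let $\varphi:\mathcal{M}_2(\mathbb{C})\to\mathcal{M}_2(\mathbb{C})$ be a linear map. The following are equivalent: 1. For every $T\in\mathcal{M}_2(\mathbb{C})$, $W_c(\varphi(T))=W_c(T)$. 2. There are a linear map $\alpha:\mathcal{M}_2(\mathbb{C})\to\mathcal{D}_{2,0}$ and a unitary $U\in\mathcal{G}_2$ such that $\varphi(T)=U^*TU+\alpha(T)$ for every $T\in\mathcal{M}_2(\mathbb{C})$.
   Context: $\mathcal{M}_n(\mathbb{C})$ is the algebra of $n\times n$ complex matrices, $\mathcal{D}_{2,0}$ is the set of diagonal $2\times2$ complex matrices with trace zero, and $\mathcal{G}_2$ is the group of $2\times 2$ unitary matrices generated by the diagonal unitary matrices and the permutation matrices. The correlation numerical range $W_c(A)$ of $A=(\alpha_{ij})\in\mathcal{M}_n(\mathbb{C})$ (used here with $n=2$) is defined as follows. Let $\hat A=(\alpha_{ij}I_n)$ be the $n\times n$ block matrix acting on $H=\mathbb{C}^n\oplus\cdots\oplus\mathbb{C}^n$ ($n$ copies), and let $E$ be the set of vectors $\frac{1}{\sqrt n}(e_1,e_2,\dots,e_n)^T\in H$ with $e_1,\dots,e_n\in\mathbb{C}^n$ and $\|e_1\|=\cdots=\|e_n\|=1$. Then $W_c(A)=\{\langle\hat A e,e\rangle: e\in E\}$. *)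

(* Defs.v *)
From HB Require Import structures.
From mathcomp Require Import all_boot all_order all_algebra.
From mathcomp Require Import boolp classical_sets reals.
From mathcomp Require Import complex.

Set Implicit Arguments.
Unset Strict Implicit.
Unset Printing Implicit Defensive.

Import Order.TTheory GRing.Theory Num.Theory.

Local Open Scope classical_set_scope.
Local Open Scope ring_scope.
Local Open Scope sesquilinear_scope.

Section CorrelationNumericalRange.
Variable C : numClosedFieldType.

(* Linear in [x], conjugate-linear in [y]; [dotmx] acts on row vectors. *)
Definition inner m (x y : 'cV[C]_m) : C := dotmx x^T y^T.

Definition l2norm m (x : 'cV[C]_m) : C := sqrtC (inner x x).

(* The direct sum of [n] copies of C^n is modelled by the block column vectors
   of height [\sum_(i < n) n]. *)
Definition ampliation n (A : 'M[C]_n) :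
    'M[C]_(\sum_(i < n) n, \sum_(j < n) n) :=
  \mxblock_(i < n, j < n) ((A i j)%:M : 'M[C]_n).

Definition corr_vectors n : set 'cV[C]_(\sum_(i < n) n) :=
  [set (sqrtC n%:R)^-1 *: (\mxcol_(i < n) e i)
     | e in [set e : 'I_n -> 'cV[C]_n | forall i, l2norm (e i) = 1]].

Definition Wc n (A : 'M[C]_n) : set C :=
  [set inner (ampliation A *m e) e | e in @corr_vectors n].

Definition traceless_diag n : set 'M[C]_n :=
  [set D | is_diag_mx D /\ \tr D = 0].

Definition unitary_subgroup n (H : set 'M[C]_n) : Prop :=
  [/\ forall U, H U -> U \is unitarymx,
      H 1%:M,
      forall U V, H U -> H V -> H (U *m V) &
      forall U, H U -> H (invmx U)].

Definition diag_perm_group n : set 'M[C]_n :=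
  smallest (@unitary_subgroup n)
    ([set U | is_diag_mx U /\ U \is unitarymx] `|` [set U | is_perm_mx U]).

End CorrelationNumericalRange.

(* Main.v *)
(* For n = 2, the set 2 W_c(A) is the ellipse {tr A + b z + c z^* : |z| <= 1},
   where (b, c) are the off-diagonal entries of A. Its support function
   Re(w^* tr A) + |w^* b + w c^*| determines tr A, bc and |b|^2 + |c|^2. If phi
   preserves W_c, then diagonal matrices go to diagonal matrices and phi acts
   on (b, c) by a linear map preserving bc and |b|^2 + |c|^2, that is by
   (b, c) |-> (u b, u^* c) or (b, c) |-> (u^* c, u b) with |u| = 1: exactly the
   action of conjugation by a monomial unitary. The remaining difference is
   diagonal with trace zero. *)
Require Import Defs.
From HB Require Import structures.
From mathcomp Require Import all_boot all_order all_algebra.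
From mathcomp Require Import boolp classical_sets reals.
From mathcomp Require Import complex.
From mathcomp Require Import fingroup perm ring.

Set Implicit Arguments.
Unset Strict Implicit.
Unset Printing Implicit Defensive.

Import Order.TTheory GRing.Theory Num.Theory.

Local Open Scope ring_scope.
Local Open Scope sesquilinear_scope.

Lemma ord2_neq (k l : 'I_2) :
  k != l -> (k = 0 /\ l = 1) \/ (k = 1 /\ l = 0).
Proof.
by case: k l => [[|[|//]] ?] [[|[|//]] ?] // _; [left | right];
  split; apply/val_inj.
Qed.

(** * Inner products of column vectors and Gram matrices *)

Section InnerProduct.
Variable C : numClosedFieldType.

Lemma innerE m (x y : 'cV[C]_m) : inner x y = \sum_k x k 0 * (y k 0)^*.
Proof. by rewrite /inner dotmxE mxE; apply: eq_bigr => k _; rewrite !mxE. Qed.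

Lemma innerZ m a (x y : 'cV[C]_m) :
  inner (a *: x) (a *: y) = a * a^* * inner x y.
Proof.
rewrite !innerE big_distrr; apply: eq_bigr => k _ /=.
by rewrite !mxE rmorphM /= mulrACA.
Qed.

Lemma inner_suml m n (a : 'I_n -> C) (x : 'I_n -> 'cV[C]_m) y :
  inner (\sum_j a j *: x j) y = \sum_j a j * inner (x j) y.
Proof.
rewrite innerE; under [RHS]eq_bigr do rewrite innerE big_distrr /=.
rewrite exchange_big; apply: eq_bigr => k _ /=.
rewrite summxE big_distrl; apply: eq_bigr => j _ /=.
by rewrite mxE mulrA.
Qed.

Lemma inner_mxcol n (p : 'I_n -> nat) (x y : forall i, 'cV[C]_(p i)) :
  inner (\mxcol_i x i) (\mxcol_i y i) = \sum_i inner (x i) (y i).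
Proof.
have innerM m (u v : 'cV[C]_m) : inner u v = (u^T *m map_mx Num.conj v) 0 0.
  by rewrite innerE mxE; apply: eq_bigr => k _; rewrite !mxE.
have -> : inner (\mxcol_i x i) (\mxcol_i y i) =
    (\mxrow_i (x i)^T *m \mxcol_i map_mx Num.conj (y i)) 0 0.
  rewrite -tr_mxcol innerM; congr ((_ *m _) 0 0).
  by apply/matrixP => s j; rewrite !mxE.
rewrite mul_mxrow_mxcol summxE.
by apply: eq_bigr => i _; rewrite innerM.
Qed.

Lemma gramE m n (E : 'M[C]_(m, n)) i j :
  (E *m E^t*) i j = inner (row i E)^T (row j E)^T.
Proof. by rewrite innerE !mxE; apply: eq_bigr => k _; rewrite !mxE. Qed.

Lemma l2norm_eq1 m (x : 'cV[C]_m) : l2norm x = 1 <-> inner x x = 1.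
Proof.
rewrite /l2norm; split => [xx | ->]; last exact: sqrtC1.
by apply: sqrtC_inj; rewrite sqrtC1.
Qed.

Lemma norm_inner_le1 m (x y : 'cV[C]_m) :
  inner x x = 1 -> inner y y = 1 -> `|inner x y| <= 1.
Proof.
rewrite /inner => xx yy; have [+ _] := CauchySchwarz (@dotmx C m) x^T y^T.
by rewrite /= xx yy mulr1 -[leRHS](expr1n _ 2) ler_sqr ?nnegrE.
Qed.

End InnerProduct.

(** * The range in terms of correlation matrices; the ellipse for [n = 2] *)

Section CorrelationRange.
Variable C : numClosedFieldType.

(* The Gram matrices [E *m E^t*] with unit diagonal are the correlation
   matrices. *)
Lemma WcE n (A : 'M[C]_n) :
  Wc A = [set n%:R^-1 * \tr (A *m (E *m E^t*))
         | E in [set E : 'M[C]_n | forall i, (E *m E^t*) i i = 1]]%classic.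
Proof.
have Wc_e (e : 'I_n -> 'cV[C]_n) :
  inner (ampliation A *m ((sqrtC n%:R)^-1 *: \mxcol_i e i))
        ((sqrtC n%:R)^-1 *: \mxcol_i e i) =
  n%:R^-1 * \sum_i \sum_j A i j * inner (e j) (e i).
  rewrite -scalemxAr innerZ fmorphV /= conj_Creal ?sqrtC_real ?ler0n //.
  rewrite -invfM -expr2 sqrtCK /ampliation mul_mxblock_mxrow inner_mxcol.
  congr (_ * _); apply: eq_bigr => i _; rewrite -inner_suml.
  by congr (inner _ _); apply: eq_bigr => j _; rewrite mul_scalar_mx.
have trE (E : 'M[C]_n) : \tr (A *m (E *m E^t*)) =
    \sum_i \sum_j A i j * inner (row j E)^T (row i E)^T.
  apply: eq_bigr => i _; rewrite mxE; apply: eq_bigr => j _.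
  by rewrite gramE.
apply/seteqP; split => [_ [_ [e e1 <-] <-] | _ [E E1 <-]].
  have rowE i : (row i (\matrix_(i, k) e i k 0))^T = e i.
    by apply/colP => k; rewrite !mxE.
  exists (\matrix_(i, k) e i k 0).
    by move=> i /=; rewrite gramE rowE; apply/l2norm_eq1/e1.
  rewrite Wc_e trE; congr (_ * _).
  by apply: eq_bigr => i _; apply: eq_bigr => j _; rewrite !rowE.
exists ((sqrtC n%:R)^-1 *: \mxcol_i (row i E)^T); last by rewrite Wc_e trE.
exists (fun i => (row i E)^T) => // i.
by apply/l2norm_eq1; rewrite -gramE.
Qed.

(** A 2 x 2 correlation matrix is determined by its entry [z] at [(1, 0)]. Cauchy-Schwarz puts [z]
    in the closed unit disc, and every point of the disc occurs. *)
Lemma Wc2E (A : 'M[C]_2) :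
  Wc A = [set 2^-1 * (\tr A + (A 0 1 * z + A 1 0 * z^*))
         | z in [set z | `|z| <= 1]]%classic.
Proof.
have tr2 (M : 'M[C]_2) : \tr M = M 0 0 + M 1 1.
  by rewrite /mxtrace !big_ord_recl big_ord0 addr0; congr (_ + M _ _); apply/val_inj.
have mul2 (M N : 'M[C]_2) i j : (M *m N) i j = M i 0 * N 0 j + M i 1 * N 1 j.
  by rewrite mxE !big_ord_recl big_ord0 addr0; congr (_ + M _ _ * N _ _); apply/val_inj.
rewrite WcE; apply/seteqP; split => [_ [E E1 <-] | _ [z z1 <-]].
  have G01 : (E *m E^t*) 0 1 = ((E *m E^t*) 1 0)^*.
    rewrite !mul2 !mxE rmorphD !rmorphM /= !conjCK.
    by rewrite [E 0 0 * _]mulrC [E 0 1 * _]mulrC.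
  exists ((E *m E^t*) 1 0) => /=.
    by rewrite gramE; apply: norm_inner_le1; rewrite -gramE E1.
  rewrite !tr2 !(mul2 A) !E1 G01; congr (_ * _); ring.
(* The Cholesky factor of the correlation matrix with entry [z]: its rows are [(1, 0)] and
   [(z, sqrt(1 - |z|^2))]. *)
pose E : 'M[C]_2 := \matrix_(i, k)
  (if i == 0 then (k == 0)%:R else if k == 0 then z else sqrtC (1 - `|z| ^+ 2)).
have s_ge0 : 0 <= 1 - `|z| ^+ 2 by rewrite subr_ge0 expr_le1.
have GE : [/\ (E *m E^t*) 0 0 = 1, (E *m E^t*) 0 1 = z^*,
              (E *m E^t*) 1 0 = z & (E *m E^t*) 1 1 = 1].
  rewrite !mul2 !mxE /= !rmorph1 !rmorph0 !(mulr0, mulr1, mul0r, mul1r, addr0).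
  split=> //; rewrite -normCK (conj_Creal (x := sqrtC _)) ?sqrtC_real //.
  by rewrite -expr2 sqrtCK addrC subrK.
case: GE => G00 G01 G10 G11; exists E.
  by case=> [[|[|//]] lt_i] /=; [rewrite -[RHS]G00 | rewrite -[RHS]G11];
    congr ((E *m E^t*) _ _); apply/val_inj.
rewrite !tr2 !(mul2 A) G00 G01 G10 G11; congr (_ * _); ring.
Qed.

(** * Transformations that leave the range unchanged *)

Lemma Wc_add_traceless_diag (A D : 'M[C]_2) :
  traceless_diag D -> Wc (A + D) = Wc A.
Proof.
case=> /is_diag_mxP D0 trD.
by rewrite !Wc2E mxtraceD trD addr0 !mxE (D0 0 1) ?(D0 1 0) ?addr0.
Qed.

(** By cyclicity of the trace, the point of the left range given by [E] is the point of [Wc A] given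
    by [U *m E], whose rows are still unit vectors. *)
Lemma Wc_conj_sub n (A U : 'M[C]_n) :
  (forall E : 'M[C]_n, (forall i, (E *m E^t*) i i = 1) ->
     forall i, (U *m E *m (U *m E)^t*) i i = 1) ->
  (Wc (U^t* *m A *m U) `<=` Wc A)%classic.
Proof.
move=> U1; rewrite !WcE => _ [E E1 <-].
exists (U *m E); first by move=> i; apply: U1.
by rewrite trmx_mul map_mxM /= !mulmxA mxtrace_mulC !mulmxA.
Qed.

(** Multiplying [E] by a diagonal unitary only rescales each row by a number of modulus 1. *)
Lemma Wc_conj_diag n (A U : 'M[C]_n) :
  is_diag_mx U -> U \is unitarymx -> Wc (U^t* *m A *m U) = Wc A.
Proof.
have sub (B V : 'M[C]_n) : is_diag_mx V -> V \is unitarymx ->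
    (Wc (V^t* *m B *m V) `<=` Wc B)%classic.
  move=> /diag_mxP[d ->] /unitarymxP d1; apply: Wc_conj_sub => E E1 i.
  have {}d1 : d 0 i * (d 0 i)^* = 1.
    move/matrixP/(_ i i): d1.
    by rewrite tr_diag_mx map_diag_mx mul_diag_mx !mxE !eqxx !mulr1n.
  rewrite trmx_mul map_mxM /= tr_diag_mx map_diag_mx /= !mulmxA -(mulmxA _ E).
  by rewrite mul_diag_mx mul_mx_diag !mxE mulrAC d1 mul1r -[RHS](E1 i) mxE.
move=> dU uU; apply/seteqP; split; first exact: sub.
(* The reverse inclusion is the first one for the diagonal unitary [U^t*], applied to the conjugated
   matrix. *)
have {1}-> : A = U^t*^t* *m (U^t* *m A *m U) *m U^t*.
  by rewrite trmxCK !mulmxA (unitarymxP uU) mul1mx -mulmxA (unitarymxP uU) mulmx1.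
apply: sub; last by rewrite trmxC_unitary.
by case/diag_mxP: dU => d ->; rewrite tr_diag_mx map_diag_mx diag_mx_is_diag.
Qed.

Lemma Wc_conj_perm n (A : 'M[C]_n) (s : 'S_n) :
  Wc ((perm_mx s)^t* *m A *m perm_mx s) = Wc A.
Proof.
have sub (B : 'M[C]_n) (t : 'S_n) :
    (Wc ((perm_mx t)^t* *m B *m perm_mx t) `<=` Wc B)%classic.
  apply: Wc_conj_sub => E E1 i; rewrite -row_permE -[RHS](E1 (t i)) !mxE.
  by apply: eq_bigr => k _; rewrite !mxE.
apply/seteqP; split; first exact: sub.
have pC (t : 'S_n) : (perm_mx t)^t* = perm_mx t^-1 :> 'M[C]_n.
  by rewrite tr_perm_mx map_perm_mx.
have {1}-> : A =
    (perm_mx s^-1)^t* *m ((perm_mx s)^t* *m A *m perm_mx s) *m perm_mx s^-1.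
  rewrite !pC invgK !mulmxA -perm_mxM -mulmxA -perm_mxM mulgV.
  by rewrite perm_mx1 mul1mx mulmx1.
exact: sub.
Qed.

Lemma perm_mx_unitary n (s : 'S_n) : perm_mx s \is @unitarymx C n n.
Proof.
by apply/unitarymxP; rewrite tr_perm_mx map_perm_mx -perm_mxM mulgV perm_mx1.
Qed.

(** The unitaries whose conjugation preserves all ranges form a group [H]. It contains both kinds of
    generators, hence the group they generate. *)
Lemma Wc_conj_diag_perm n (A U : 'M[C]_n) :
  diag_perm_group U -> Wc (U^t* *m A *m U) = Wc A.
Proof.
pose H := [set U : 'M[C]_n | U \is unitarymx /\
                       forall A, Wc (U^t* *m A *m U) = Wc A]%classic.
suff: (diag_perm_group (n := n) `<=` H)%classic by move=> /[apply] -[_].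
apply: smallest_sub => [|V [[dV uV]|/is_perm_mxP[s ->]]].
- split => [V [] //||V W [uV HV] [uW HW]|V [uV HV]].
  + by split => [|B]; rewrite -?perm_mx1 ?perm_mx_unitary // Wc_conj_perm.
  + split => [|B]; first exact: mul_unitarymx.
    by rewrite trmx_mul map_mxM -[RHS]HV -[RHS]HW !mulmxA.
  + rewrite invmx_unitary //; split => [|B]; first by rewrite trmxC_unitary.
    have VV : V^t* *m V = 1%:M.
      by have := uV; rewrite -trmxC_unitary => /unitarymxP; rewrite trmxCK.
    by rewrite -[LHS]HV trmxCK !mulmxA VV mul1mx -mulmxA VV mulmx1.
- by split => // B; apply: Wc_conj_diag.
- by split => [|B]; [exact: perm_mx_unitary | exact: Wc_conj_perm].
Qed.


(** * Support function and the invariants read off from it *)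

(* The map [w |-> Re (w^* tr A) + |w^* A01 + w A10^*|] is the support function
   of [2 Wc A]. *)
Lemma Wc2_support (A B : 'M[C]_2) w : (Wc A `<=` Wc B)%classic ->
  'Re (w^* * \tr A) + `|w^* * A 0 1 + w * (A 1 0)^*| <=
  'Re (w^* * \tr B) + `|w^* * B 0 1 + w * (B 1 0)^*|.
Proof.
(* Conjugating the term in [z^*] does not change its real part, so a single coefficient of [z]
   remains. *)
have Re_pt (M : 'M[C]_2) z :
    'Re (w^* * (\tr M + (M 0 1 * z + M 1 0 * z^*))) =
    'Re (w^* * \tr M) + 'Re ((w^* * M 0 1 + w * (M 1 0)^*) * z).
  by rewrite !ReE !(rmorphD, rmorphM) /= !conjCK; field.
set v := _ + w * (A 1 0)^*; set u := _ + w * (B 1 0)^*; rewrite !Wc2E => sAB.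
(* This point maximizes [Re (v z)] over the disc, with value [|v|]. For [v = 0] it is 0, by the
   convention on division by zero. *)
have z1 : `|v^* / `|v| | <= 1.
  rewrite normrM normfV normr_id norm_conjC.
  by have [->|v0] := eqVneq v 0; rewrite ?normr0 ?mul0r // divff ?normr_eq0.
have [|z' z'1] := sAB (2^-1 *
    (\tr A + (A 0 1 * (v^* / `|v|) + A 1 0 * (v^* / `|v|)^*))).
  by exists (v^* / `|v|).
have V2 : (2^-1 : C) != 0 by rewrite invr_eq0 pnatr_eq0.
move/(mulfI V2) => /(congr1 (fun x => 'Re (w^* * x))).
rewrite !Re_pt -/v -/u mulrA -normCK.
have -> : `|v| ^+ 2 / `|v| = `|v|.
  by have [->|v0] := eqVneq v 0; rewrite ?normr0 ?invr0 ?mulr0 // expr2 mulfK ?normr_eq0.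
rewrite (Creal_ReP _ (normr_real _)) => <-; rewrite lerD2l.
apply: (le_trans (leif_Re_Creal _).1).
by rewrite normrM ler_piMr.
Qed.

Lemma Wc2_invariants (A B : 'M[C]_2) : Wc A = Wc B ->
  [/\ \tr A = \tr B, A 0 1 * A 1 0 = B 0 1 * B 1 0 &
      `|A 0 1| ^+ 2 + `|A 1 0| ^+ 2 = `|B 0 1| ^+ 2 + `|B 1 0| ^+ 2].
Proof.
move=> AB.
have H w : 'Re (w^* * \tr A) + `|w^* * A 0 1 + w * (A 1 0)^*| =
           'Re (w^* * \tr B) + `|w^* * B 0 1 + w * (B 1 0)^*|.
  by apply/le_anti/andP; split; apply: Wc2_support; rewrite AB.
(* Under [w |-> -w] the trace term is odd and the modulus is even, so the two terms agree
   separately. *)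
have HN w : - 'Re (w^* * \tr A) + `|w^* * A 0 1 + w * (A 1 0)^*| =
            - 'Re (w^* * \tr B) + `|w^* * B 0 1 + w * (B 1 0)^*|.
  by have := H (- w); rewrite !rmorphN !mulNr !raddfN /= -!opprD !normrN.
have Hre w : 'Re (w^* * \tr A) = 'Re (w^* * \tr B).
  have := congr2 (fun x y => (x - y) / 2) (H w) (HN w).
  have half (x y : C) : (x + y - (- x + y)) / 2 = x.
    by field.
  by rewrite !half.
have Hn w : `|w^* * A 0 1 + w * (A 1 0)^*| = `|w^* * B 0 1 + w * (B 1 0)^*|.
  by have := H w; rewrite Hre => /addrI.
(* [X] is the square of the support term, with [a = |A01|^2 + |A10|^2] and
   [p = A01 A10]; its values at [1], ['i] and [1 + 'i] determine [a] and [p]. *)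
pose X a p w : C := w * w^* * a + (w^* ^+ 2 * p + w ^+ 2 * p^*).
have XE w : X (`|A 0 1| ^+ 2 + `|A 1 0| ^+ 2) (A 0 1 * A 1 0) w =
            X (`|B 0 1| ^+ 2 + `|B 1 0| ^+ 2) (B 0 1 * B 1 0) w.
  have := congr1 (fun x => x ^+ 2) (Hn w).
  rewrite /X !normCK !(rmorphD, rmorphM) /= !conjCK => E.
  by apply: etrans (etrans E _); ring.
have X1 a p : X a p 1 = a + (p + p^*) by rewrite /X rmorph1; ring.
have Xi a p : X a p 'i = a - (p + p^*).
  by rewrite /X conjCi sqrrN sqrCi mulrN mulCii; ring.
have X1i a p : X a p (1 + 'i) = 2 * a - 2 * 'i * (p - p^*).
  have -> : X a p (1 + 'i) =
      (1 - 'i * 'i) * a + (1 + 'i * 'i) * (p + p^*) - 2 * 'i * (p - p^*).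
    by rewrite /X rmorphD rmorph1 /= conjCi; ring.
  by rewrite mulCii; ring.
have a_X a p : a = (X a p 1 + X a p 'i) / 2 by rewrite X1 Xi; field.
(* The first summand is [Re p], the second is [i Im p]. *)
have p_X a p : p = (X a p 1 - X a p 'i) / 4
    + 'i * (X a p (1 + 'i) - X a p 1 - X a p 'i) / 4.
  rewrite X1 Xi X1i; transitivity ((p + p^*) / 2 - 'i * 'i * (p - p^*) / 2).
    by rewrite mulCii; field.
  by field.
split.
- apply/eqCP; split; first by have := Hre 1; rewrite rmorph1 !mul1r.
  by have := Hre 'i; rewrite conjCi !mulNr !raddfN /= !ReMil !opprK.
- by rewrite [LHS](p_X (`|A 0 1| ^+ 2 + `|A 1 0| ^+ 2)) !XE -p_X.
- by rewrite [LHS](a_X _ (A 0 1 * A 1 0)) !XE -a_X.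
Qed.

(** * Monomial unitaries and the classification of the preservers *)

Lemma unitary_diag_mx n (d : 'rV[C]_n) :
  (forall k, `|d 0 k| = 1) -> diag_mx d \is unitarymx.
Proof.
move=> d1; apply/unitarymxP; rewrite tr_diag_mx map_diag_mx mulmx_diag.
rewrite -diag_const_mx; congr diag_mx; apply/rowP => k.
by rewrite !mxE -normCK d1 expr1n.
Qed.

Lemma diag_perm_group_monomial n (d : 'rV[C]_n) (s : 'S_n) :
  (forall k, `|d 0 k| = 1) -> diag_perm_group (diag_mx d *m perm_mx s).
Proof.
move=> d1 H [[_ _ HM _] sH]; apply: HM; apply: sH; [left | right].
  by split; [exact: diag_mx_is_diag | exact: unitary_diag_mx].
exact: perm_mx_is_perm.
Qed.

Lemma conj_monomialE n (d : 'rV[C]_n) (s : 'S_n) (A : 'M[C]_n) k l :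
  let U := diag_mx d *m perm_mx s^-1 in
  (U^t* *m A *m U) k l = (d 0 (s k))^* * A (s k) (s l) * d 0 (s l).
Proof.
rewrite /= trmx_mul map_mxM /= tr_diag_mx tr_perm_mx map_perm_mx map_diag_mx invgK.
rewrite -!mulmxA -row_permE !mulmxA -col_permE /=.
by rewrite mul_mx_diag 2!mxE mul_diag_mx !mxE.
Qed.

Lemma Wc2_preserver (phi : {linear 'M[C]_2 -> 'M[C]_2}) :
  (forall T, Wc (phi T) = Wc T) <->
  (exists (alpha : {linear 'M[C]_2 -> 'M[C]_2}) (U : 'M[C]_2),
      [/\ forall T, traceless_diag (alpha T), diag_perm_group U &
          forall T, phi T = U^t* *m T *m U + alpha T]).
Proof.
split=> [phiW | [alpha [U [a0 GU phiE]]] T]; last first.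
  by rewrite phiE Wc_add_traceless_diag // Wc_conj_diag_perm.
(* It suffices to match the off-diagonal entries with a monomial conjugation: the difference is then
   diagonal, and it has trace zero because both images have the range, hence the trace, of [T]. *)
suff [d [s [d1 off]]] : exists (d : 'rV[C]_2) (s : 'S_2),
    (forall k, `|d 0 k| = 1) /\
    forall T k l, k != l ->
      phi T k l = (d 0 (s k))^* * T (s k) (s l) * d 0 (s l).
  pose U := diag_mx d *m perm_mx s^-1.
  have GU : diag_perm_group U by exact: diag_perm_group_monomial.
  exists (phi \- (mulmxr U \o mulmx (U^t*))), U; split => // T; last first.
    by rewrite /= addrC subrK.
  split; last first.
    rewrite /= raddfB /=; apply/eqP; rewrite subr_eq0; apply/eqP.
    case: (@Wc2_invariants (phi T) (U^t* *m T *m U)) => //.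
    by rewrite phiW Wc_conj_diag_perm.
  by apply/is_diag_mxP => k l kl; rewrite 2!mxE conj_monomialE off ?subrr.
have prodE T : phi T 0 1 * phi T 1 0 = T 0 1 * T 1 0.
  by case: (Wc2_invariants (phiW T)).
have normE T : `|phi T 0 1| ^+ 2 + `|phi T 1 0| ^+ 2 = `|T 0 1| ^+ 2 + `|T 1 0| ^+ 2.
  by case: (Wc2_invariants (phiW T)).
have diag0 i : phi (delta_mx i i) 0 1 = 0 /\ phi (delta_mx i i) 1 0 = 0.
  have D0 : (delta_mx i i : 'M[C]_2) 0 1 = 0 /\ (delta_mx i i : 'M[C]_2) 1 0 = 0.
    by rewrite !mxE; case: i => [[|[|]]].
  have := normE (delta_mx i i); rewrite D0.1 D0.2 normr0 expr0n addr0 => /eqP.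
  rewrite paddr_eq0 ?exprn_ge0 // !expf_eq0 /= !normr_eq0.
  by case/andP => /eqP-> /eqP->.
(* The off-diagonal pair (b, c) of T is sent to (p b + q c, r b + t c). *)
pose p := phi (delta_mx 0 1) 0 1; pose q := phi (delta_mx 1 0) 0 1.
pose r := phi (delta_mx 0 1) 1 0; pose t := phi (delta_mx 1 0) 1 0.
have phiT T k l : phi T k l =
    T 0 0 * phi (delta_mx 0 0) k l + T 0 1 * phi (delta_mx 0 1) k l
    + (T 1 0 * phi (delta_mx 1 0) k l + T 1 1 * phi (delta_mx 1 1) k l).
  have {1}-> : T = T 0 0 *: delta_mx 0 0 + T 0 1 *: delta_mx 0 1
             + (T 1 0 *: delta_mx 1 0 + T 1 1 *: delta_mx 1 1).
    apply/matrixP => -[[|[|//]] li] [[|[|//]] lj]; rewrite !mxE /=;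
      rewrite !(mulr0, mulr1, addr0, add0r); congr (T _ _); exact/val_inj.
  by rewrite !linearD !linearZ !mxE.
have phi01 T : phi T 0 1 = T 0 1 * p + T 1 0 * q.
  by rewrite phiT !(proj1 (diag0 _)) !mulr0 add0r addr0.
have phi10 T : phi T 1 0 = T 0 1 * r + T 1 0 * t.
  by rewrite phiT !(proj2 (diag0 _)) !mulr0 add0r addr0.
(* The invariant product is evaluated at the two off-diagonal matrix units and at their sum. *)
have pr0 : p * r = 0 by rewrite prodE !mxE mulr0.
have qt0 : q * t = 0 by rewrite prodE !mxE mul0r.
have pqrt : (p + q) * (r + t) = 1.
  have := prodE (delta_mx 0 1 + delta_mx 1 0).
  by rewrite phi01 phi10 !mxE /= !(addr0, add0r, mul1r).
have n_pr : `|p| ^+ 2 + `|r| ^+ 2 = 1.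
  by rewrite normE !mxE normr1 normr0 expr1n expr0n addr0.
(* As [p * r = 0], either [r = 0] and the off-diagonal entries stay in place, or [p = 0] and they
   are swapped. *)
have [r0|r_neq0] := eqVneq r 0.
  have t_neq0 : t != 0.
    by apply: contra_eq_neq pqrt => ->; rewrite r0 addr0 mulr0 eq_sym oner_eq0.
  have q0 : q = 0 by apply/eqP; move/eqP: qt0; rewrite mulf_eq0 (negPf t_neq0) orbF.
  have pt : p * t = 1 by rewrite -pqrt q0 r0 addr0 add0r.
  have p1 : `|p| = 1.
    by apply/eqP; rewrite -(@pexpr_eq1 _ _ 2) // -n_pr r0 normr0 expr0n addr0.
  have tE : t = p^*.
    by rewrite -[LHS]mul1r -(expr1n _ 2) -p1 normCKC -mulrA pt mulr1.
  (* Conjugation by [diag(1, p)] sends [(b, c)] to [(p b, p^* c)]. *)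
  exists (\row_k if k == 0 then 1 else p), 1%g; split.
    by move=> k; rewrite mxE; case: ifP; rewrite ?normr1.
  move=> T k l kl; rewrite !perm1 !mxE.
  have [[-> ->]|[-> ->]] := ord2_neq kl.
  - by rewrite phi01 q0 /= rmorph1 mulr0 addr0 mul1r.
  - by rewrite phi10 r0 tE /= mulr0 add0r mulr1 mulrC.
have p0 : p = 0 by apply/eqP; move/eqP: pr0; rewrite mulf_eq0 (negPf r_neq0) orbF.
have q_neq0 : q != 0.
  by apply: contra_eq_neq pqrt => ->; rewrite p0 addr0 mul0r eq_sym oner_eq0.
have t0 : t = 0 by apply/eqP; move/eqP: qt0; rewrite mulf_eq0 (negPf q_neq0).
have qr : q * r = 1 by rewrite -pqrt p0 t0 addr0 add0r.
have r1 : `|r| = 1.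
  by apply/eqP; rewrite -(@pexpr_eq1 _ _ 2) // -n_pr p0 normr0 expr0n add0r.
have qE : q = r^*.
  by rewrite -[LHS]mulr1 -(expr1n _ 2) -r1 normCK mulrA qr mul1r.
(* With the transposition, [diag(r^*, 1)] sends [(b, c)] to [(r^* c, r b)]. *)
exists (\row_k if k == 0 then r^* else 1), (tperm 0 1); split.
  by move=> k; rewrite mxE; case: ifP; rewrite ?normr1 ?norm_conjC.
move=> T k l kl; rewrite !mxE.
have [[-> ->]|[-> ->]] := ord2_neq kl.
- by rewrite tpermL tpermR phi01 p0 qE /= rmorph1 mulr0 add0r mul1r.
- by rewrite tpermL tpermR phi10 t0 /= conjCK mulr0 addr0 mulr1 mulrC.
Qed.

End CorrelationRange.

Theorem theorem12 (R : realType)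
    (phi : {linear 'M[R[i]]_2 -> 'M[R[i]]_2}) :
  (forall T : 'M[R[i]]_2, Wc (phi T) = Wc T)
  <->
  (exists (alpha : {linear 'M[R[i]]_2 -> 'M[R[i]]_2}) (U : 'M[R[i]]_2),
      [/\ forall T : 'M[R[i]]_2, traceless_diag (alpha T),
          diag_perm_group U &
          forall T : 'M[R[i]]_2, phi T = U^t* *m T *m U + alpha T]).
Proof. exact: Wc2_preserver. Qed.
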